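(* Let $\theta=(k_r)$ be a lacunary sequence with $\liminf_r q_r>1$. A subset $A$ of $\mathbb{R}$ is bounded if and only if it is $N_\theta$-ward compact.
   Context: A lacunary sequence is an increasing sequence of integers $\theta=(k_r)_{r\ge 0}$ with $k_0=0$ and $h_r:=k_r-k_{r-1}\to\infty$. Put $I_r=(k_{r-1},k_r]$ (integers in this interval) and $q_r=k_r/k_{r-1}$ (for $r\ge 2$). A real sequence $(\alpha_k)_{k\ge1}$ is $N_\theta$-quasi-Cauchy if $\lim_{r\to\infty}\frac1{h_r}\sum_{k\in I_r}|\alpha_{k+1}-\alpha_k|=0$. A set $A\subset\mathbb{R}$ is $N_\theta$-ward compact if every sequence $(\alpha_n)$ of points in $A$ has a subsequence $(z_k)=(\alpha_{n_k})$ that is $N_\theta$-quasi-Cauchy (as a sequence indexed by $k$). *)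

(* Defs.v *)
From HB Require Import structures.
From mathcomp Require Import all_boot all_order all_algebra.
From mathcomp Require Import all_classical all_reals all_analysis.
Set Implicit Arguments.
Unset Strict Implicit.
Unset Printing Implicit Defensive.
Import Order.TTheory GRing.Theory Num.Theory.
Import numFieldNormedType.Exports.
Local Open Scope classical_set_scope.
Local Open Scope ring_scope.

(* [increasing_seq] is strict monotonicity, so integers starting at 0 lie in
   [nat].  The lengths h_r (r >= 1) and ratios q_r (r >= 2) are indexed by all
   of [nat]; the values at smaller r are meaningless, but only limits as r
   tends to infinity are taken. *)

Definition block_length (k : nat -> nat) (r : nat) : nat := (k r - k r.-1)%N.

Definition block_ratio (R : realType) (k : nat -> nat) (r : nat) : R :=
  (k r)%:R / (k r.-1)%:R.

Definition lacunary (k : nat -> nat) : Prop :=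
  [/\ increasing_seq k, k 0%N = 0%N & block_length k r @[r --> \oo] --> \oo].

(* Sequences are indexed from 1: the value at index 0 is never used. *)

Definition Ntheta_quasi_Cauchy (R : realType) (k : nat -> nat)
    (alpha : nat -> R) : Prop :=
  ((block_length k r)%:R^-1 *
    \sum_((k r.-1).+1 <= i < (k r).+1) `|alpha i.+1 - alpha i|)
  @[r --> \oo] --> (0 : R).

Definition Ntheta_ward_compact (R : realType) (k : nat -> nat)
    (A : set R) : Prop :=
  forall alpha : nat -> R, (forall n, (0 < n)%N -> A (alpha n)) ->
  exists2 phi : nat -> nat, increasing_seq phi &
    Ntheta_quasi_Cauchy k (alpha \o phi).

(* Main.v *)
(* A bounded sequence has a convergent subsequence, whose consecutive
   differences tend to 0, hence so do their block averages.  An unbounded set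
   contains a sequence with |alpha_{n+1}| >= |alpha_n| + 1; the terms of every
   subsequence are then at mutual distance at least 1, so every block average
   is at least 1. *)
Require Import Defs.
From HB Require Import structures.
From mathcomp Require Import all_boot all_order all_algebra.
From mathcomp Require Import all_classical all_reals all_analysis.
Import Order.TTheory GRing.Theory Num.Theory.
Import numFieldNormedType.Exports.
Local Open Scope classical_set_scope.
Local Open Scope ring_scope.

Section BlockAverage.
Variables (R : realType) (k : nat -> nat).
Hypothesis k_incr : increasing_seq k.

Lemma block_length_gt0 r : (0 < r)%N -> (0 < block_length k r)%N.
Proof.
case: r => // r _; rewrite /block_length subn_gt0 /=.
by have /increasing_seqP := k_incr; exact.
Qed.

(** Guarantees that the blocks move off to infinity, so that a tail estimate on a sequence controls
    all late blocks. *)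
Lemma leq_increasing_seq n : (n <= k n)%N.
Proof.
elim: n => // n /leq_ltn_trans; apply.
by have /increasing_seqP := k_incr; exact.
Qed.

Lemma block_sum_const r (e : R) :
  \sum_((k r.-1).+1 <= i < (k r).+1) e = (block_length k r)%:R * e.
Proof. by rewrite sumr_const_nat subSS mulr_natl. Qed.

Lemma block_average_le r (f : nat -> R) e : 0 <= e ->
    (forall i, (k r.-1 < i)%N -> f i <= e) ->
  (block_length k r)%:R^-1 * \sum_((k r.-1).+1 <= i < (k r).+1) f i <= e.
Proof.
(* The block is empty at [r = 0]; there the average is 0, since the inverse of 0 is 0, and [0 <= e]
   is what bounds it. *)
move=> e0 fe; have [->|h0] := posnP (block_length k r).
  by rewrite invr0 mul0r.
rewrite ler_pdivrMl ?ltr0n// -block_sum_const.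
by apply: ler_sum_nat => i /andP[/fe].
Qed.

Lemma block_average_ge r (f : nat -> R) e : (0 < r)%N ->
    (forall i, (k r.-1 < i)%N -> e <= f i) ->
  e <= (block_length k r)%:R^-1 * \sum_((k r.-1).+1 <= i < (k r).+1) f i.
Proof.
move=> r0 fe.
rewrite ler_pdivlMl ?ltr0n ?block_length_gt0// -block_sum_const.
by apply: ler_sum_nat => i /andP[/fe].
Qed.

Lemma cvgn_Ntheta_quasi_Cauchy (z : nat -> R) :
  cvgn z -> Ntheta_quasi_Cauchy k z.
Proof.
move=> z_cvg.
have dz0 : (fun n => z n.+1 - z n) @ \oo --> (0 : R).
  rewrite -(subrr (limn z)); apply: cvgB => //.
  by have := z_cvg; rewrite -cvg_shiftS.
apply/cvgrPdist_le => e e0; move/cvgrPdist_le : dz0 => /(_ e e0)[N _ Nz].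
(* The shift by one pays for the predecessor: every index [i] in block [r] satisfies
   [i > k r.-1 >= r.-1 >= N]. *)
exists N.+1 => // r /= Nr; rewrite sub0r normrN ger0_norm; last first.
  by rewrite mulr_ge0// sumr_ge0.
apply: block_average_le => [|i ki]; first exact: ltW.
have := Nz i; rewrite sub0r normrN; apply => /=.
case: r Nr ki => // r; rewrite ltnS /= => Nr ki.
exact: leq_trans Nr (leq_trans (leq_increasing_seq r) (ltnW ki)).
Qed.

Lemma separated_not_Ntheta_quasi_Cauchy (z : nat -> R) :
  (forall n, 1 <= `|z n.+1 - z n|) -> ~ Ntheta_quasi_Cauchy k z.
Proof.
(* Evaluating at [N.+1] rather than [N] makes the block nonempty, as [block_average_ge] requires. *)
move=> z1 /cvgrPdist_lt/(_ 1 ltr01)[N _ /(_ N.+1 (leqnSn _))].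
have avg1 : 1 <= (block_length k N.+1)%:R^-1 *
    \sum_((k N.+1.-1).+1 <= i < (k N.+1).+1) `|z i.+1 - z i|.
  exact: block_average_ge.
by rewrite sub0r normrN ger0_norm ?(le_trans ler01)// ltNge avg1.
Qed.

End BlockAverage.

Lemma unbounded_separated_seq (R : realType) (A : set R) : ~ bounded_set A ->
  exists2 alpha : nat -> R, (forall n, A (alpha n)) &
    forall m n, (m < n)%N -> 1 <= `|alpha n - alpha m|.
Proof.
move=> A_unbounded.
have /choice[f Af] : forall M : R, exists x, A x /\ M < `|x|.
  move=> M; apply: contrapT => noM; apply: A_unbounded.
  exists M; split; first exact: num_real.
  move=> y My x Ax; apply: le_trans (ltW My).
  by rewrite leNgt; apply/negP => Mx; apply: noM; exists x.
pose alpha n := iter n (fun x => f (`|x| + 1)) (f 0).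
exists alpha => [[|n]|m n mn]; [exact: (Af _).1|exact: (Af _).1|].
have alphaS i : `|alpha i| + 1 <= `|alpha i.+1| by exact/ltW/(Af _).2.
(* By the reverse triangle inequality it is enough to separate the norms, which increase with the
   index: the jump from [m] to [m.+1] already gives 1. *)
apply: le_trans (lerB_dist _ _); rewrite lerBrDl.
apply: le_trans (alphaS m) _.
have /nondecreasing_seqP : forall i, `|alpha i| <= `|alpha i.+1|.
  by move=> i; apply: le_trans (alphaS i); rewrite lerDl.
exact.
Qed.

Theorem theorem11 (R : realType) (k : nat -> nat) (hk : lacunary k)
    (hq : (1 < limn_einf (fun r => (block_ratio R k r)%:E))%E) (A : set R) :
  bounded_set A <-> Ntheta_ward_compact k A.
Proof.
have [k_incr _ _] := hk; split => [A_bounded alpha Aalpha|A_compact].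
  (* The value [alpha 0] need not lie in [A], so the shifted sequence is used; the extraction
     becomes [S \o phi], whose indices are all positive. *)
  have [|phi phi_incr alpha_cvg] := @bolzano_weierstrass R (alpha \o S).
    have [M [M_real AM]] := A_bounded.
    by exists M; split=> // y /AM Ay n _; apply/Ay/Aalpha.
  exists (S \o phi); first by move=> m n; rewrite -phi_incr.
  exact: cvgn_Ntheta_quasi_Cauchy.
apply: contrapT => /unbounded_separated_seq[alpha Aalpha alpha_sep].
have [//|phi phi_incr] := A_compact alpha.
apply: separated_not_Ntheta_quasi_Cauchy => // n; apply: alpha_sep.
by have /increasing_seqP := phi_incr; exact.
Qed.
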